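(* Let $C_n$ be the empirical copula of a sample $\boldsymbol{X}_1,\dots,\boldsymbol{X}_n$ of random vectors in $\mathbb{R}^d$, and let $\mathrm{P}_n$, $\mathrm{E}_n$ denote conditional probability and expectation given the sample. Under $\mathrm{P}_n$, let $\boldsymbol{U}^*=(U_1^*,\dots,U_d^* )$ have distribution function $C_n$, let $\boldsymbol{V}=(V_1,\dots,V_d)$ follow a GPD-copula with generator $\boldsymbol{Z}=(Z_1,\dots,Z_d)$, and let $\boldsymbol{U}^*$ and $\boldsymbol{V}$ be independent. Let the threshold $\boldsymbol{u}=(u_1,\dots,u_d)\in(0,1)^d$ satisfy $\mathrm{P}_n(\boldsymbol{U}^*>\boldsymbol{u})>0$, put $u_i^*:=\mathrm{P}_n(U_i^*\le u_i)$, $\boldsymbol{u}^*:=(u_1^*,\dots,u_d^* )$, and $$Y_i^*:=U_i^*\,\mathbf{1}(U_i^*\le u_i)+\{u_i^*+(1-u_i^* )V_i\}\,\mathbf{1}(U_i^*>u_i),\qquad 1\le i\le d.$$ Then the random vector $\boldsymbol{Y}^*=(Y_1^*,\dots,Y_d^* )$ follows a multivariate GPD, whose distribution function coincides on $[\boldsymbol{0},\min(\boldsymbol{u},\boldsymbol{u}^* )]$ (componentwise minimum) with $C_n$ and which satisfies, for $\boldsymbol{x}<\boldsymbol{1}$ large enough (i.e. for all $\boldsymbol{x}_0\le\boldsymbol{x}<\boldsymbol{1}$ with some $\boldsymbol{x}_0<\boldsymbol{1}$), $$\mathrm{P}_n(\boldsymbol{Y}^*\le\boldsymbol{x})=1-\|\boldsymbol{x}-\boldsymbol{1}\|_{D_n},$$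 where the $D$-norm is given by $$\|\boldsymbol{x}\|_{D_n}=\mathrm{E}_n\left[\max_{1\le j\le d}\left\{|x_j|\,Z_j\,\frac{\mathbf{1}(U_j^*>u_j)}{1-u_j^*}\right\}\right],\qquad \boldsymbol{x}\in\mathbb{R}^d,$$ the generator $\boldsymbol{Z}$ and $\boldsymbol{U}^*$ being independent.
   Context: All operations and inequalities between vectors are componentwise; $\boldsymbol{0}=(0,\dots,0)$, $\boldsymbol{1}=(1,\dots,1)$; $\mathbf{1}(A)$ is the indicator of the event $A$. Empirical copula: let $\boldsymbol{X}_i=(X_i^{(1)},\dots,X_i^{(d)})$, $1\le i\le n$, be $n$ copies of a random vector $\boldsymbol{X}$. For $1\le j\le d$ put $F_n^{(j)}(x):=\frac1{n+1}\sum_{i=1}^n\mathbf{1}(X_i^{(j)}\le x)$, $x\in\mathbb{R}$, and $\boldsymbol{R}_i:=(F_n^{(1)}(X_i^{(1)}),\dots,F_n^{(d)}(X_i^{(d)}))$. The empirical copula is $C_n(\boldsymbol{w})=\frac1n\sum_{i=1}^n\mathbf{1}(\boldsymbol{R}_i\le\boldsymbol{w})$, $\boldsymbol{w}\in[0,1]^d$. A $D$-norm on $\mathbb{R}^d$ is a norm of the form $\|\boldsymbol{x}\|_D=\mathrm{E}\{\max_{1\le i\le d}(|x_i|Z_i)\}$, where $\boldsymbol{Z}=(Z_1,\dots,Z_d)$ is a random vector with $\boldsymbol{Z}\in[0,c]^d$ for some $c>0$ and $\mathrm{E}(Z_i)=1$ for $1\le i\le d$; such a $\boldsymbol{Z}$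 is called a generator of $\|\cdot\|_D$. A copula $C$ on $[0,1]^d$ is called a GPD-copula with generator $\boldsymbol{Z}$ if there exists $\boldsymbol{u}_0<\boldsymbol{1}$ such that $C(\boldsymbol{w})=1-\|\boldsymbol{w}-\boldsymbol{1}\|_D$ for all $\boldsymbol{w}\in[0,1]^d$ with $\boldsymbol{w}\ge\boldsymbol{u}_0$, where $\|\cdot\|_D$ is the $D$-norm generated by $\boldsymbol{Z}$. A $d$-dimensional extreme value distribution (EVD) is a max-stable distribution function $G$, i.e. for every $n\in\mathbb{N}$ there exist $\boldsymbol{c}_n>\boldsymbol{0}$, $\boldsymbol{d}_n\in\mathbb{R}^d$ with $G^n(\boldsymbol{c}_n\boldsymbol{x}+\boldsymbol{d}_n)=G(\boldsymbol{x})$ for all $\boldsymbol{x}\in\mathbb{R}^d$ (with non-degenerate univariate margins). A $d$-dimensional distribution function $Q$ is called a multivariate generalized Pareto distribution (GPD) if there exist a $d$-dimensional EVD $G$ and $\boldsymbol{x}_0\in\mathbb{R}^d$ with $G(\boldsymbol{x}_0)<1$ such that $Q(\boldsymbol{x})=1+\ln\{G(\boldsymbol{x})\}$ for all $\boldsymbol{x}\ge\boldsymbol{x}_0$. *)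

(* Defs.v *)
From HB Require Import structures.
From mathcomp Require Import all_boot all_order all_algebra.
From mathcomp Require Import all_classical all_reals all_analysis.
Set Implicit Arguments.
Unset Strict Implicit.
Unset Printing Implicit Defensive.
Import Order.TTheory GRing.Theory Num.Theory.
Import numFieldNormedType.Exports.
Local Open Scope classical_set_scope.
Local Open Scope ring_scope.

Section Vectors.
Context {R : realType} {d : nat}.
Implicit Types x y w : 'rV[R]_d.

Definition lev x y : bool := [forall j, x ord0 j <= y ord0 j].

(* Strict in every component, hence not the strict part of [lev]. *)
Definition ltv x y : bool := [forall j, x ord0 j < y ord0 j].

Definition zerov : 'rV[R]_d := const_mx 0.
Definition onev : 'rV[R]_d := const_mx 1.
Definition minv x y : 'rV[R]_d := \row_j Num.min (x ord0 j) (y ord0 j).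

Definition in_cube w : bool := lev zerov w && lev w onev.

Definition set_coord x (i : 'I_d) (t : R) : 'rV[R]_d :=
  \row_j (if j == i then t else x ord0 j).

End Vectors.

Section RandomVectors.
Context {R : realType} {disp : measure_display} {T : measurableType disp}.

Definition is_rvec (I : Type) (W : I -> T -> R) : Prop :=
  forall i, measurable_fun [set: T] (W i).

Definition dfun (P : probability T R) d (W : 'I_d -> T -> R) (x : 'rV[R]_d) : R :=
  fine (P [set t | forall j, W j t <= x ord0 j]).

Definition sigma_gen (I : Type) (W : I -> T -> R) : set_system T :=
  <<s [set A | exists (i : I) (B : set R), measurable B /\ A = W i @^-1` B] >>.

Definition independent (P : probability T R) (I J : Type)
    (W : I -> T -> R) (W' : J -> T -> R) : Prop :=
  forall A B, sigma_gen W A -> sigma_gen W' B ->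
    P (A `&` B) = (P A * P B)%E.

(* [Q] is a regular version of P( . | G). *)
Definition is_cond_prob (P : probability T R) (G : set_system T)
    (Q : T -> probability T R) : Prop :=
  (forall A, measurable A -> forall B : set R, measurable B ->
     G [set w | B (fine (Q w A))]) /\
  (forall A B, measurable A -> G B ->
     (\int[P]_(w in B) Q w A)%E = P (A `&` B)).

End RandomVectors.

Section EmpiricalCopula.
Context {R : realType} {d n : nat}.
Variable x : 'I_n -> 'rV[R]_d.

Definition edf (j : 'I_d) (t : R) : R :=
  (n.+1)%:R^-1 * \sum_(i < n) (x i ord0 j <= t)%R%:R.

Definition ranks (i : 'I_n) : 'rV[R]_d := \row_j edf j (x i ord0 j).

Definition empirical_copula (w : 'rV[R]_d) : R :=
  n%:R^-1 * \sum_(i < n) (lev (ranks i) w)%:R.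

End EmpiricalCopula.

Section DNorms.
Context {R : realType}.

Definition is_norm d (N : 'rV[R]_d -> R) : Prop :=
  [/\ forall x, N x = 0 -> x = 0,
      forall (a : R) x, N (a *: x) = `|a| * N x &
      forall x y, N (x + y) <= N x + N y].

Definition is_generator disp (T : measurableType disp) (P : probability T R)
    d (Z : 'I_d -> T -> R) : Prop :=
  [/\ is_rvec Z,
      exists2 c : R, 0 < c & {ae P, forall t, forall j, 0 <= Z j t <= c} &
      forall j, ('E_P[Z j] = 1)%E].

(* The seed 0 of the maximum is harmless: the terms are nonnegative a.s. *)
Definition Dnorm disp (T : measurableType disp) (P : probability T R)
    d (Z : 'I_d -> T -> R) (x : 'rV[R]_d) : R :=
  fine ('E_P[fun t => (\big[Num.max/0]_(j < d) (`|x ord0 j| * Z j t))%R])%E.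

Definition is_Dnorm d (N : 'rV[R]_d -> R) : Prop :=
  is_norm N /\
  exists (disp : measure_display) (T : measurableType disp)
    (P : probability T R) (Z : 'I_d -> T -> R),
    is_generator P Z /\ N = Dnorm P Z.

End DNorms.

Section DistributionFunctions.
Context {R : realType} {d : nat}.
Implicit Types (F G Q C : 'rV[R]_d -> R) (a b x w : 'rV[R]_d).

(* Mass given by F to the box ]a, b]: alternating sum over its vertices. *)
Definition box_mass F a b : R :=
  \sum_(S : {set 'I_d})
    (-1) ^+ #|S| * F (\row_j (if j \in S then a ord0 j else b ord0 j)).

(* The d-variate analogue of the library's [cumulativeBounded 0 1]. *)
Definition is_df F : Prop :=
  [/\ forall a b, lev a b -> 0 <= box_mass F a b,
      forall x, F y @[y --> within [set y | lev x y] (nbhs x)] --> F x,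
      forall x i, F (set_coord x i t) @[t --> -oo] --> (0 : R) &
      F (const_mx t) @[t --> +oo] --> (1 : R)].

Definition margin F (i : 'I_d) (t : R) : R :=
  lim (F (set_coord (const_mx s) i t) @[s --> +oo]).

Definition degenerate (f : R -> R) : Prop :=
  exists a : R, forall t, f t = (a <= t)%R%:R.

Definition max_stable G : Prop :=
  forall n, (0 < n)%N -> exists c e : 'rV[R]_d, ltv zerov c /\
    forall x, G (\row_j (c ord0 j * x ord0 j + e ord0 j)) ^+ n = G x.

Definition is_EVD G : Prop :=
  [/\ is_df G, forall i, ~ degenerate (margin G i) & max_stable G].

(* [0 < G x0] makes the logarithm meaningful, since [ln 0 = 0] here. *)
Definition is_GPD Q : Prop :=
  is_df Q /\
  exists G x0, [/\ is_EVD G, 0 < G x0 < 1 &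
    forall x, lev x0 x -> Q x = 1 + ln (G x)].

(* Only the values of C on the unit cube matter. *)
Definition is_copula C : Prop :=
  [/\ forall w j, in_cube w -> w ord0 j = 0 -> C w = 0,
      forall j (t : R), 0 <= t <= 1 -> C (set_coord onev j t) = t &
      forall a b, in_cube a -> in_cube b -> lev a b -> 0 <= box_mass C a b].

Definition is_GPD_copula disp (T : measurableType disp) (P : probability T R)
    (Z : 'I_d -> T -> R) C : Prop :=
  is_copula C /\
  exists2 u0, ltv u0 onev &
    forall w, in_cube w -> lev u0 w -> C w = 1 - Dnorm P Z (w - onev).

End DistributionFunctions.

Section PiecingTogether.
Context {R : realType} {disp : measure_display} {T : measurableType disp}.
Variables (P : probability T R) (d : nat) (U V : 'I_d -> T -> R) (u : 'rV[R]_d).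

Definition ustar : 'rV[R]_d := \row_j fine (P [set t | U j t <= u ord0 j]).

Definition Ystar (j : 'I_d) (t : T) : R :=
  U j t * (U j t <= u ord0 j)%R%:R +
  (ustar ord0 j + (1 - ustar ord0 j) * V j t) * (u ord0 j < U j t)%R%:R.

Definition Dn (Z : 'I_d -> T -> R) (x : 'rV[R]_d) : R :=
  fine ('E_P[fun t => (\big[Num.max/0]_(j < d)
    (`|x ord0 j| * Z j t * ((u ord0 j < U j t)%R%:R / (1 - ustar ord0 j))))%R])%E.

End PiecingTogether.

(* Main.v *)
Require Import Defs.
From mathcomp Require Import all_boot all_order all_algebra.
From mathcomp Require Import all_classical all_reals all_analysis.
From mathcomp Require Import measurable_realfun ring lra.
From HB Require Import structures.
Import Order.TTheory GRing.Theory Num.Theory.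
Import numFieldNormedType.Exports.
Local Open Scope classical_set_scope.
Local Open Scope ring_scope.
Set Implicit Arguments.
Unset Strict Implicit.
Unset Printing Implicit Defensive.

(** Write S for the random set of components in which U* exceeds the threshold
    u. Given S, the vector Y* coincides with U* outside S and with an affine
    image of V, of lower endpoint u* and upper endpoint 1, inside S.

    Near the upper endpoint this determines everything. If u <= x <= 1, the event
    Y* <= x only constrains the components in S, where it reads
    V_j <= 1 + (x_j - 1)/(1 - u*_j). Since V is independent of S, averaging
    over S the value 1 - ||.|| of the copula of V gives
    P(Y* <= x) = 1 - E max_j |x_j - 1| Z_j 1(U_j > u_j)/(1 - u*_j)
    ([dfun_exceedances], [Dn_exceedances], [dfun_Ystar_tail]). The factors
    1(U_j > u_j)/(1 - u*_j) are independent of Z and have mean 1, so the right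
    hand side is a D-norm ([exceedance_generatorP], [Dnorm_is_Dnorm]). Below
    both u and u* the event Y* <= x excludes any exceedance up to a null event,
    and Y* is distributed as U* ([dfun_Ystar_head]).

    That Y* follows a generalized Pareto distribution means that
    G(x) = exp(-||min(x, 1) - 1||) is an extreme value distribution. Max
    stability is the homogeneity of the norm. The substantial point is that G
    gives nonnegative mass to boxes. It follows from the tail formula for the
    distribution function H of Y*: by homogeneity,
    G(x) = exp(m (H(1 + (x - 1)/m) - 1)) for m large, a nonnegative combination
    of powers of a distribution function ([evd_box_mass_ge0]). That powers of
    a distribution function have nonnegative box masses is proved from the
    representation of its values at the vertices of a box as sums of
    nonnegative weights over supersets, which is stable under products
    ([superset_sumM]). *)

(** * Independence and total probability *)

Section Independence.
Context {R : realType} {disp : measure_display} {T : measurableType disp}.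

(** The generators of [sigma_gen W], named so that a function of the vector W
    can be treated as a measurable function on the measurable type
    [g_sigma_algebraType (coordinate_events W)]. *)
Definition coordinate_events (I : Type) (W : I -> T -> R) : set_system T :=
  [set A | exists (i : I) (B : set R), measurable B /\ A = W i @^-1` B].

Lemma sigma_genE (I : Type) (W : I -> T -> R) :
  sigma_gen W = (coordinate_events W).-sigma.-measurable.
Proof. by []. Qed.

Lemma measurable_coordinate (I : Type) (W : I -> T -> R) i :
  measurable_fun [set: g_sigma_algebraType (coordinate_events W)] (W i).
Proof.
by move=> _ B mB; rewrite setTI; apply: sub_sigma_algebra; exists i, B.
Qed.

Lemma sigma_gen_measurable (I : Type) (W : I -> T -> R) (A : set T) :
  is_rvec W -> sigma_gen W A -> measurable A.
Proof.
move=> rW; apply: smallest_sub; first exact: sigma_algebra_measurable.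
by move=> _ [i [B [mB ->]]]; rewrite -[_ @^-1` _]setTI; exact: rW.
Qed.

Lemma sigma_gen_measurable_fun (I : Type) (W : I -> T -> R) (g : T -> R) :
  is_rvec W ->
  measurable_fun [set: g_sigma_algebraType (coordinate_events W)] g ->
  measurable_fun [set: T] g.
Proof.
move=> rW mg _ B mB; rewrite setTI; apply: (sigma_gen_measurable rW).
by have := mg measurableT _ mB; rewrite setTI.
Qed.

Lemma independent_sym (P : probability T R) (I J : Type)
    (W : I -> T -> R) (W' : J -> T -> R) :
  independent P W W' -> independent P W' W.
Proof. by move=> ind A B WA WB; rewrite setIC muleC; exact: ind. Qed.

(** The value 0 does not contribute to an integral; discarding it is what lets
    a law be compared on subsets of ]0, +oo[ only. *)
Lemma integral_preimage_gt0 (P : probability T R) (f : T -> R) :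
  (forall t, 0 <= f t) ->
  (\int[P]_(t in f @^-1` `]0%R, +oo[) (f t)%:E = \int[P]_t (f t)%:E)%E.
Proof.
move=> f0; rewrite integral_mkcond; apply: eq_integral => t _.
rewrite patchE; case: ifPn => //; rewrite notin_setE /= in_itv /= andbT.
by move=> /negP; rewrite -leNgt => ft; congr EFin; apply/eqP; rewrite eq_le f0.
Qed.

(** Inside ]0, +oo[ the law of 1_A g is P A times the law of g, because
    1_A g lands in a set avoiding 0 exactly when A occurs and g lands there;
    integrating the identity against both measures gives the product rule. *)
Lemma integral_indic_independent (P : probability T R) (A : set T) (g : T -> R) :
  measurable A -> measurable_fun [set: T] g -> (forall t, 0 <= g t) ->
  (forall B : set R, measurable B ->
    P (A `&` g @^-1` B) = (P A * P (g @^-1` B))%E) ->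
  (\int[P]_t (\1_A t * g t)%:E = P A * \int[P]_t (g t)%:E)%E.
Proof.
move=> mA mg g0 ind.
pose f t : R := \1_A t * g t.
have mf : measurable_fun [set: T] f.
  by apply: measurable_funM => //; exact: measurable_indic.
have f0 t : 0 <= f t by rewrite mulr_ge0.
pose gX : {mfun T >-> R} := HB.pack g (isMeasurableFun.Build _ _ _ _ _ mg).
pose fX : {mfun T >-> R} := HB.pack f (isMeasurableFun.Build _ _ _ _ _ mf).
rewrite -(integral_preimage_gt0 P f0) -(integral_preimage_gt0 P g0).
have pos : {in (`]0%R, +oo[%classic : set R), forall y : R, (0 <= y%:E)%E}.
  by move=> y; rewrite inE /= in_itv /= andbT lee_fin => /ltW.
rewrite -[LHS](@ge0_integral_pushforward _ _ _ _ _ f mf P _ EFin) //.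
rewrite -[X in (_ * X)%E](@ge0_integral_pushforward _ _ _ _ _ g mg P _ EFin) //.
have -> : P A = (fine (P A))%:E by rewrite fineK ?fin_num_measure.
pose k : {nonneg R} := NngNum (fine_ge0 (measure_ge0 P A)).
pose D : set R := `]0%R, +oo[%classic.
transitivity (\int[mscale k (distribution P gX)]_(y in D) y%:E)%E; last first.
  rewrite (ge0_integral_mscale _ (measurable_itv _)) //.
  by move=> y yD; apply: pos; rewrite inE.
transitivity (\int[distribution P fX]_(y in D) y%:E)%E => //.
apply: eq_measure_integral => B mB B0 /=.
rewrite /pushforward /mscale /= fineK ?fin_num_measure // -ind //.
congr (P _); apply/seteqP; split => t /=; rewrite /f indicE.
  case: (boolP (t \in A)) => [tA|_]; first by rewrite mul1r -[A t]inE.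
  by rewrite mul0r => /B0; rewrite /D /= in_itv /= ltxx.
by move=> [tA]; rewrite mem_set // mul1r.
Qed.

(** If K depends on W only and takes finitely many values, then conditioning on
    the value of K leaves the law of the independent vector W' unchanged, so K
    may be frozen inside the integrand. The distribution function of Y* and
    the norm D_n are both computed with this lemma, K being the set of
    components in which U* exceeds the threshold. *)
Lemma integral_freeze (P : probability T R) (F : finType) (I J : Type)
    (W : I -> T -> R) (W' : J -> T -> R) (K : T -> F) (g : F -> T -> R) :
  is_rvec W -> is_rvec W' -> independent P W W' ->
  (forall k, sigma_gen W (K @^-1` [set k])) ->
  (forall k, measurable_fun
     [set: g_sigma_algebraType (coordinate_events W')] (g k)) ->
  (forall k t, 0 <= g k t) ->
  (\int[P]_t (g (K t) t)%:E =
   \sum_k P (K @^-1` [set k]) * \int[P]_t (g k t)%:E)%E.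
Proof.
move=> rW rW' ind mK mg g0.
have mKT k : measurable (K @^-1` [set k]) by exact: (sigma_gen_measurable rW (mK k)).
have mgT k : measurable_fun [set: T] (g k) by exact: (sigma_gen_measurable_fun rW' (mg k)).
under eq_integral => t _.
  have -> : (g (K t) t)%:E = (\sum_k (\1_(K @^-1` [set k]) t * g k t)%:E)%E.
    rewrite (bigD1 (K t)) //= big1 ?adde0 => [|k kK].
      by rewrite indicE mem_set ?mul1r.
    rewrite indicE memNset ?mul0r // => /= Kk.
    by move: kK; rewrite -Kk eqxx.
  over.
rewrite ge0_integral_sum //.
- apply: eq_bigr => k _; apply: integral_indic_independent => // B mB.
  apply: ind => //; have := mg k measurableT _ mB.
  by rewrite setTI.
- by move=> k; apply/measurable_EFinP/measurable_funM => //; exact: measurable_indic.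
- by move=> k t _; rewrite lee_fin mulr_ge0.
Qed.

Lemma total_probability (P : probability T R) (F : finType) (K : T -> F)
    (A : set T) :
  (forall k, measurable (K @^-1` [set k])) -> measurable A ->
  (P A = \sum_k P (A `&` K @^-1` [set k]))%E.
Proof.
move=> mK mA; rewrite -(setIT A) -integral_indic //.
transitivity (\int[P]_t (\sum_k (\1_(A `&` K @^-1` [set k]) t)%:E))%E.
  apply: eq_integral => t _; rewrite (bigD1 (K t)) //= big1 ?adde0 => [|k kK].
    congr EFin; rewrite !indicE; congr (nat_of_bool _)%:R.
    by apply/idP/idP; rewrite !inE => // -[].
  rewrite indicE memNset // => -[_ /= Kk].
  by move: kK; rewrite -Kk eqxx.
rewrite ge0_integral_sum //.
- by apply: eq_bigr => k _; rewrite integral_indic ?setIT //; exact: measurableI.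
- by move=> k; apply/measurable_EFinP/measurable_indic; exact: measurableI.
Qed.

End Independence.

(** * Nonnegative superset sums *)

Section SupersetSums.
Context {R : realType} {I : finType}.
Implicit Types (f q : {set I} -> R) (A S : {set I}).

(** The values of a distribution function at the vertices of a box are of this
    form: q A is the mass of the part of the orthant below the upper vertex in
    which exactly the components in A stay below the lower vertex. The
    existence of q is a condition on all the lower-dimensional margins at
    once, which is why, unlike nonnegativity of the alternating sum alone, it
    is preserved by products. *)
Definition superset_sum f : Prop :=
  exists2 q : {set I} -> R, (forall A, 0 <= q A) &
    forall S, f S = \sum_(A : {set I} | S \subset A) q A.

Definition alternating_sum f : R := \sum_(S : {set I}) (-1) ^+ #|S| * f S.

(** Expand the product over i of (1 - [i in A]). *)
Lemma alternating_sum_subset A :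
  \sum_(S : {set I} | S \subset A) (-1) ^+ #|S| = (A == finset.set0)%:R :> R.
Proof.
transitivity (\prod_(i : I) (- (i \in A)%:R + 1) : R); last first.
  have [->|/finset.set0Pn [i iA]] := eqVneq.
    by rewrite big1 // => i _; rewrite inE oppr0 add0r.
  by rewrite (bigD1 i) //= iA addNr mul0r.
rewrite bigA_distr big_mkcond /=; apply: eq_bigr => S _.
rewrite -big_mkcond /=; case: ifPn => [SA|/fintype.subsetPn[i iS iA]].
  under eq_bigr => i iS do rewrite (fintype.subsetP SA _ iS).
  by rewrite prodr_const.
by rewrite (bigD1 i) //= (negbTE iA) oppr0 mul0r.
Qed.

(** Moebius inversion: the alternating sum recovers q at the empty set. *)
Lemma alternating_sum_ge0 f : superset_sum f -> 0 <= alternating_sum f.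
Proof.
move=> [q q0 fq].
suff -> : alternating_sum f = q finset.set0 by [].
rewrite /alternating_sum; under eq_bigr => S _ do rewrite fq mulr_sumr.
rewrite (exchange_big_dep predT) //= (bigD1 finset.set0) //= [X in _ + X]big1.
  by rewrite -mulr_suml alternating_sum_subset eqxx mul1r addr0.
by move=> A A0; rewrite -mulr_suml alternating_sum_subset (negbTE A0) mul0r.
Qed.

Lemma superset_sum1 : superset_sum (fun=> 1).
Proof.
exists (fun A : {set I} => (A == [set: I]%SET)%:R) => [//|S].
rewrite (bigD1 [set: I]%SET) ?finset.subsetT //= eqxx big1 ?addr0 // => A /andP[_ /negbTE ->].
by [].
Qed.

Lemma superset_sumZ c f : 0 <= c -> superset_sum f ->
  superset_sum (fun S => c * f S).
Proof.
move=> c0 [q q0 fq]; exists (fun A => c * q A) => [A|S]; first exact: mulr_ge0.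
by rewrite fq mulr_sumr.
Qed.

(** S is contained in both A and A' if and only if it is contained in their
    intersection, so the product has as weights the convolution of the weights
    with respect to intersection. In probabilistic terms, the product of
    two distribution functions is that of the componentwise maximum of
    independent vectors. *)
Lemma superset_sumM f g : superset_sum f -> superset_sum g ->
  superset_sum (fun S => f S * g S).
Proof.
move=> [q q0 fq] [r r0 gr].
exists (fun B => \sum_(p : {set I} * {set I} | p.1 :&: p.2 == B) q p.1 * r p.2)
  => [B|S]; first by apply: sumr_ge0 => p _; exact: mulr_ge0.
rewrite fq gr mulr_suml; under eq_bigr => A _ do rewrite mulr_sumr.
rewrite pair_big /=.
rewrite (partition_big (fun p : {set I} * {set I} => p.1 :&: p.2)
  (fun B => S \subset B)) /=; last by move=> p; rewrite finset.subsetI.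
apply: eq_bigr => B SB; apply: eq_bigl => p.
by rewrite -finset.subsetI andbC; case: eqP => // ->.
Qed.

Lemma superset_sumX f k : superset_sum f -> superset_sum (fun S => f S ^+ k).
Proof.
move=> sf; elim: k => [|k IH]; first by under eq_fun do rewrite expr0; exact: superset_sum1.
by under eq_fun do rewrite exprS; exact: superset_sumM.
Qed.

(** The exponential is a limit of nonnegative combinations of powers. *)
Lemma alternating_sum_expR_ge0 f : superset_sum f ->
  0 <= alternating_sum (fun S => expR (f S)).
Proof.
move=> sf.
have cvg : alternating_sum (fun S => series (exp_coeff (f S)) n) @[n --> \oo]
    --> alternating_sum (fun S => expR (f S)).
  apply: (cvg_big add_continuous) => S _; apply: cvgMl_tmp.
  exact: is_cvg_series_exp_coeff.
rewrite -(cvg_lim _ cvg) //; apply: limr_ge; first by apply/cvg_ex; eexists; exact: cvg.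
near=> n.
have -> : alternating_sum (fun S => series (exp_coeff (f S)) n) =
    \sum_(0 <= k < n) k`!%:R^-1 * alternating_sum (fun S => f S ^+ k).
  rewrite /alternating_sum /series /=.
  under eq_bigr => S _ do rewrite mulr_sumr.
  rewrite exchange_big /=; apply: eq_bigr => k _.
  by rewrite mulr_sumr; apply: eq_bigr => S _; rewrite /exp_coeff /= mulrA mulrC.
by apply: sumr_ge0 => k _; rewrite mulr_ge0 // alternating_sum_ge0 //;
  exact: superset_sumX.
Unshelve. all: by end_near. Qed.

End SupersetSums.

(** * Distribution functions of random vectors *)

Section Measurability.
Context {R : realType} {disp : measure_display} {T : measurableType disp}.

Lemma measurable_forall (I : finType) (A : I -> set T) :
  (forall i, measurable (A i)) -> measurable [set t | forall i, A i t].
Proof.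
move=> mA; have -> : [set t | forall i, A i t] = \bigcap_(i in [set: I]) A i.
  by apply/seteqP; split => t /= At i; [move=> _|]; exact: At.
by apply: fin_bigcap_measurable => // i _; exact: mA.
Qed.

Lemma measurable_finset_fiber (I : finType) (b : I -> T -> bool) (A : {set I}) :
  (forall i, measurable [set t | b i t]) ->
  measurable ((fun t => [set i | b i t]%SET) @^-1` [set A]).
Proof.
move=> mb.
have -> : (fun t => [set i | b i t]%SET) @^-1` [set A] =
    [set t | forall i, [set t | b i t = (i \in A)] t].
  apply/seteqP; split => t /= => [<- i|bA]; first by rewrite inE.
  by apply/setP => i; rewrite inE bA.
apply: measurable_forall => i; case: (i \in A); first exact: mb.
rewrite (_ : mkset _ = ~` [set t | b i t]); first exact: measurableC.
by apply/seteqP; split => t /=; [move=> ->|move/negP/negbTE].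
Qed.

Lemma measurable_bigmax (I : Type) (r : seq I) (f0 : T -> R) (f : I -> T -> R) :
  measurable_fun [set: T] f0 -> (forall i, measurable_fun [set: T] (f i)) ->
  measurable_fun [set: T] (fun t => \big[Num.max/f0 t]_(i <- r) f i t).
Proof.
move=> mf0 mf; elim: r => [|i r IH].
  by under eq_fun do rewrite big_nil.
by under eq_fun do rewrite big_cons; exact: measurable_maxr.
Qed.

Lemma measurable_le_cst (f : T -> R) (a : R) :
  measurable_fun [set: T] f -> measurable [set t | f t <= a].
Proof.
move=> mf; rewrite -[X in measurable X]setTI.
rewrite (_ : mkset _ = f @^-1` `]-oo, a]); first exact: mf.
by apply/seteqP; split => t /=; rewrite in_itv.
Qed.

Lemma measurable_gt_cst (f : T -> R) (a : R) :
  measurable_fun [set: T] f -> measurable [set t | a < f t].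
Proof.
move=> mf; rewrite -[X in measurable X]setTI.
rewrite (_ : mkset _ = f @^-1` `]a, +oo[); first exact: mf.
by apply/seteqP; split => t /=; rewrite in_itv /= andbT.
Qed.

End Measurability.

Section DistributionFunction.
Context {R : realType} {disp : measure_display} {T : measurableType disp}.
Variables (P : probability T R) (d : nat) (W : 'I_d -> T -> R).
Hypothesis rW : is_rvec W.
Implicit Types x y a b : 'rV[R]_d.

Definition lower_orthant x : set T := [set t | forall j, W j t <= x ord0 j].

Lemma measurable_lower_orthant x : measurable (lower_orthant x).
Proof. by apply: measurable_forall => j; exact: measurable_le_cst. Qed.

Lemma le_dfun x y : lev x y -> dfun P W x <= dfun P W y.
Proof.
move=> /forallP xy; apply: fine_le; rewrite ?fin_num_measure //;
  try exact: measurable_lower_orthant.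
apply: le_measure; rewrite ?inE; try exact: measurable_lower_orthant.
by move=> t /= Wx j; exact: le_trans (xy j).
Qed.

Lemma dfun_superset_sum a b : lev a b ->
  superset_sum (fun S : {set 'I_d} =>
    dfun P W (\row_j (if j \in S then a ord0 j else b ord0 j))).
Proof.
move=> /forallP ab.
pose K t := [set j | W j t <= a ord0 j]%SET.
have mK A : measurable (K @^-1` [set A]).
  by apply: measurable_finset_fiber => j; exact: measurable_le_cst.
pose q A := fine (P (lower_orthant b `&` K @^-1` [set A])).
exists q => [A|S]; first exact: fine_ge0.
rewrite /dfun -/(lower_orthant _) (@total_probability _ _ _ P _ K) //;
  last exact: measurable_lower_orthant.
rewrite -sum_fine => [|A _]; last first.
  by rewrite fin_num_measure //; apply: measurableI => //; exact: measurable_lower_orthant.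
rewrite [RHS]big_mkcond; apply: eq_bigr => A _.
case: ifPn => [SA|/fintype.subsetPn[j jS jA]].
  congr (fine (P _)); apply/seteqP; split => t /= [Wt KA]; split => // j.
    by apply: le_trans (Wt j) _; rewrite mxE; case: ifP.
  rewrite mxE; case: ifPn => [jS|_]; last exact: Wt.
  by have /(fintype.subsetP SA) := jS; rewrite -KA inE.
rewrite (_ : _ `&` _ = set0) ?measure0 //; apply/seteqP; split => // t /= [Wt KA].
by move: (Wt j) jA; rewrite mxE jS -KA inE => ->.
Qed.

(** With M = max_j (W_j - x_j), the events M <= s and W <= x + (s,...,s)
    coincide, so that limits of the d-variate function along a diagonal are
    limits of a univariate distribution function. *)
Lemma dfun_diagonal (i0 : 'I_d) x : exists M : {RV P >-> R},
  forall s : R, (dfun P W (x + const_mx s))%:E = cdf M s.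
Proof.
pose M t := \big[Num.max/W i0 t - x ord0 i0]_(j < d) (W j t - x ord0 j).
have mM : measurable_fun [set: T] M.
  by apply: measurable_bigmax => [|j]; apply: measurable_funB => //; exact: rW.
pose MX : {mfun T >-> R} := HB.pack M (isMeasurableFun.Build _ _ _ _ _ mM).
exists MX => s.
rewrite /dfun fineK ?fin_num_measure //; last exact: measurable_lower_orthant.
congr (P _); apply/seteqP; split => t /=; rewrite in_itv /=.
  have Ws j : (W j t - x ord0 j <= s) = (W j t <= (x + const_mx s) ord0 j).
    by rewrite !mxE lerBlDl.
  by move=> Wt; apply/bigmax_leP; split => [|j _]; rewrite Ws.
by move/bigmax_leP => [_ Mt] j; rewrite !mxE -lerBlDl Mt.
Qed.

(** Right continuity reduces to the diagonal through x, because a point y >= x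
    close to x lies below a point of that diagonal close to x. *)
Lemma dfun_is_df : (0 < d)%N -> is_df (dfun P W).
Proof.
move=> d0; pose i0 : 'I_d := Ordinal d0; split.
- by move=> a b ab; exact: alternating_sum_ge0 (dfun_superset_sum ab).
- move=> x.
  have [M FM] := dfun_diagonal i0 x.
  have Fx : cdf M 0 = (dfun P W x)%:E by rewrite -FM (_ : x + _ = x) //;
    apply/rowP => j; rewrite !mxE addr0.
  have rc : dfun P W (x + const_mx s) @[s --> 0^'+] --> dfun P W x.
    have := @cdf_right_continuous _ _ _ P M 0.
    rewrite Fx -(funext FM).
    by move/fine_cvgP => [].
  apply/cvgrPdist_lt => e e0.
  have [s /andP[s0 Fs]] : exists s, (0 < s) && (dfun P W (x + const_mx s) < dfun P W x + e).
    have /cvgrPdist_lt/(_ _ e0) := rc => near_e.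
    have [s [s0 Fs]] := @filter_ex _ _ (at_right_proper_filter 0) _
      (filterI (nbhs_right_gt 0) near_e).
    by exists s; rewrite s0 /=; move: Fs; rewrite ltr_distlC => /andP[].
  near=> y.
  have xy : lev x y by near: y; exact: withinT.
  have ys : lev y (x + const_mx s).
    apply/forallP => j; rewrite !mxE.
    suff : `|x ord0 j - y ord0 j| < s by rewrite ltr_distlC => /andP[_ /ltW].
    have [_ xys] : ball x s y by near: y; apply: cvg_within; exact: nbhsx_ballx.
    exact: xys.
  have Fxy := le_dfun xy; have Fys := le_dfun ys.
  rewrite ler0_norm; lra.
- move=> x i.
  pose Wi : {mfun T >-> R} := HB.pack (W i) (isMeasurableFun.Build _ _ _ _ _ (rW i)).
  have Wi0 : fine (cdf (Wi : {RV P >-> R}) t) @[t --> -oo] --> 0.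
    by have /fine_cvgP[] := @cvg_cdfNy0 _ _ _ P Wi.
  apply: (squeeze_cvgr _ (cvg_cst 0) Wi0); near=> t; apply/andP; split.
    exact: fine_ge0.
  apply: fine_le; rewrite ?fin_num_measure //; first exact: measurable_lower_orthant.
  apply: le_measure; rewrite ?inE; first exact: measurable_lower_orthant.
    exact: measurable_funPTI.
  by move=> s /= /(_ i); rewrite in_itv mxE eqxx.
- have [M FM] := dfun_diagonal i0 0.
  have := @cvg_cdfy1 _ _ _ P M.
  by rewrite -(funext FM); under eq_fun do rewrite add0r; move/fine_cvgP => [].
Unshelve. all: by end_near. Qed.

End DistributionFunction.

(** * D-norms *)

Section DNorm.
Context {R : realType} {disp : measure_display} {T : measurableType disp}.
Variables (P : probability T R) (d : nat).
Implicit Types (Z : 'I_d -> T -> R) (x y : 'rV[R]_d).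

Definition weighted_max Z x (t : T) : R :=
  \big[Num.max/0]_(j < d) (`|x ord0 j| * Z j t).

Lemma DnormE Z x : Dnorm P Z x = (\int[P]_t weighted_max Z x t)%R.
Proof. by rewrite /Dnorm unlock. Qed.

Lemma weighted_max_ge0 Z x t : 0 <= weighted_max Z x t.
Proof. exact: bigmax_ge_id. Qed.

Lemma weighted_max_ge Z x j t : `|x ord0 j| * Z j t <= weighted_max Z x t.
Proof. exact: le_bigmax. Qed.

Lemma weighted_maxZ Z a x t :
  weighted_max Z (a *: x) t = `|a| * weighted_max Z x t.
Proof.
rewrite /weighted_max; apply: (big_rec2 (fun u v => u = `|a| * v)).
  by rewrite mulr0.
by move=> j u v _ ->; rewrite mxE normrM -mulrA maxr_pMr.
Qed.

(** The bound holds also where some Z_j is negative, since such a component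
    contributes a term below the seed 0 of the maximum. *)
Lemma weighted_maxD Z x y t :
  weighted_max Z (x + y) t <= weighted_max Z x t + weighted_max Z y t.
Proof.
apply/bigmax_leP; split => [|j _]; first by rewrite addr_ge0 ?weighted_max_ge0.
have [Z0|/ltW Z0] := leP 0 (Z j t); last first.
  by rewrite (le_trans (mulr_ge0_le0 _ Z0)) // addr_ge0 ?weighted_max_ge0.
rewrite mxE (le_trans (ler_wpM2r Z0 (ler_normD _ _))) // mulrDl lerD //;
  exact: weighted_max_ge.
Qed.

Lemma weighted_max_le Z x t :
  weighted_max Z x t <= \sum_j `|x ord0 j| * `|Z j t|.
Proof.
apply/bigmax_leP; split => [|j _]; first by apply: sumr_ge0 => j _; rewrite mulr_ge0.
rewrite (bigD1 j) //= (le_trans (ler_wpM2l _ (ler_norm _))) // lerDl.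
by apply: sumr_ge0 => i _; rewrite mulr_ge0.
Qed.

Lemma measurable_weighted_max Z x : is_rvec Z ->
  measurable_fun [set: T] (weighted_max Z x).
Proof.
move=> rZ; apply: measurable_bigmax => // j.
by apply: measurable_funM => //; exact: rZ.
Qed.

Section Generator.
Variable Z : 'I_d -> T -> R.
Hypothesis genZ : is_generator P Z.

Lemma generator_rvec : is_rvec Z. Proof. by case: genZ. Qed.

Lemma integral_abs_generator j : (\int[P]_t `|Z j t|%:E = 1)%E.
Proof.
have [rZ [c c0 Zc] EZ] := genZ; rewrite -(EZ j) unlock.
apply: ae_eq_integral => //.
- by apply/measurable_EFinP; apply: measurableT_comp => //; exact: rZ.
- by apply/measurable_EFinP; exact: rZ.
by apply: filterS Zc => t Zt _; have /andP[Z0 _] := Zt j; rewrite ger0_norm.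
Qed.

Lemma integrable_generator j : P.-integrable [set: T] (EFin \o Z j).
Proof.
apply/integrableP; split; first by apply/measurable_EFinP; exact: generator_rvec.
by under eq_integral do rewrite /= ; rewrite integral_abs_generator ltry.
Qed.

(** The maximum is at most the sum, and E|Z_j| = 1. The bound gives both the
    integrability of the maximum and the Lipschitz estimate for the D-norm. *)
Lemma integral_weighted_max_le x :
  (\int[P]_t (weighted_max Z x t)%:E <= (\sum_j `|x ord0 j|)%:E)%E.
Proof.
have mabs j : measurable_fun [set: T] (fun t => `|Z j t|%:E).
  by apply/measurable_EFinP; apply: measurableT_comp => //; exact: generator_rvec.
apply: (@le_trans _ _
    (\int[P]_t (\sum_j (`|x ord0 j|%:E * `|Z j t|%:E))%E)%E); last first.
  rewrite ge0_integral_sum //.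
  - rewrite -sumEFin; apply: lee_sum => j _.
    by rewrite ge0_integralZl // ?integral_abs_generator ?mule1.
  by move=> j; exact: measurable_funeM.
apply: ge0_le_integral => //.
- by move=> t _; rewrite lee_fin weighted_max_ge0.
- by apply/measurable_EFinP; exact: measurable_weighted_max generator_rvec.
- by apply: emeasurable_sum => j; exact: measurable_funeM.
by move=> t _; rewrite sumEFin lee_fin; exact: weighted_max_le.
Qed.

Lemma integrable_weighted_max x :
  P.-integrable [set: T] (EFin \o weighted_max Z x).
Proof.
apply/integrableP; split.
  by apply/measurable_EFinP; exact: measurable_weighted_max generator_rvec.
under eq_integral do rewrite /= ger0_norm ?weighted_max_ge0 //.
by rewrite (le_lt_trans (integral_weighted_max_le _)) ?ltry.
Qed.

Lemma Dnorm_le x : Dnorm P Z x <= \sum_j `|x ord0 j|.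
Proof.
rewrite DnormE -lee_fin fineK; first exact: integral_weighted_max_le.
exact: integrable_fin_num (integrable_weighted_max x).
Qed.

(** The maximum dominates each of its terms and E Z_j = 1. This gives
    definiteness of the norm, and later the decay of the extreme value
    distribution at minus infinity. *)
Lemma Dnorm_ge x j : `|x ord0 j| <= Dnorm P Z x.
Proof.
have [_ _ EZ] := genZ.
have -> : `|x ord0 j| = (\int[P]_t (`|x ord0 j| * Z j t))%R.
  rewrite RintegralZl //; last exact: integrable_generator.
  by have := EZ j; rewrite unlock /Rintegral => ->; rewrite mulr1.
rewrite DnormE; apply: le_Rintegral => //.
- by apply: (integrableZl measurableT _ (integrable_generator j)).
- exact: integrable_weighted_max.
by move=> t _; exact: weighted_max_ge.
Qed.

Lemma DnormZ a x : Dnorm P Z (a *: x) = `|a| * Dnorm P Z x.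
Proof.
rewrite !DnormE -RintegralZl //; last exact: integrable_weighted_max.
by apply: eq_Rintegral => t _; exact: weighted_maxZ.
Qed.

Lemma DnormD x y : Dnorm P Z (x + y) <= Dnorm P Z x + Dnorm P Z y.
Proof.
have ix := integrable_weighted_max x; have iy := integrable_weighted_max y.
rewrite !DnormE -RintegralD //; apply: le_Rintegral => //.
- exact: integrable_weighted_max.
- exact: (integrableD measurableT ix iy).
by move=> t _; exact: weighted_maxD.
Qed.

Lemma Dnorm_is_Dnorm : is_Dnorm (Dnorm P Z).
Proof.
split; last by exists disp, T, P, Z.
split; [|exact: DnormZ|exact: DnormD] => x x0.
apply/rowP => j; rewrite mxE; apply/normr0_eq0/le_anti.
by rewrite normr_ge0 andbT -x0 Dnorm_ge.
Qed.

Lemma Dnorm_dist x y :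
  `|Dnorm P Z x - Dnorm P Z y| <= \sum_j `|x ord0 j - y ord0 j|.
Proof.
have sub u v : Dnorm P Z u - Dnorm P Z v <= \sum_j `|u ord0 j - v ord0 j|.
  rewrite lerBlDl -{1}(subrK v u) addrC (le_trans (DnormD _ _)) // lerD2l.
  by rewrite (le_trans (Dnorm_le _)) // ler_sum // => j _; rewrite !mxE.
rewrite ler_norml lerNl opprB !sub !andbT.
by under eq_bigr do rewrite distrC; exact: sub.
Qed.

End Generator.

End DNorm.

(** * The extreme value distribution of a D-norm *)

Section ExtremeValue.
Context {R : realType} {d : nat}.
Implicit Types x y : 'rV[R]_d.

(** min(x, 1) - 1: a vector bounded above by 1 has the same distribution
    function at x and at min(x, 1). *)
Definition capped_shift x : 'rV[R]_d := \row_j Num.min (x ord0 j - 1) 0.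

(** The dilation of center (1,...,1) and ratio 1/m. *)
Definition zoom (m : R) x : 'rV[R]_d := \row_j (1 + m^-1 * (x ord0 j - 1)).

Lemma capped_shift_zoom m x : 0 < m -> capped_shift (zoom m x) = m^-1 *: capped_shift x.
Proof.
move=> m0; apply/rowP => j; rewrite !mxE addrAC subrr add0r.
by rewrite minr_pMr ?invr_ge0 ?ltW // mulr0.
Qed.

Lemma capped_shift_dist x y j :
  `|capped_shift x ord0 j - capped_shift y ord0 j| <= `|x ord0 j - y ord0 j|.
Proof.
rewrite !mxE; move: (x _ _) (y _ _) => a b.
by rewrite ler_norml !minEle; case: ifPn; case: ifPn; rewrite -?ltNge;
  move=> ? ?; have := ler_norm (a - b); have := lerNnormlW (lexx `|a - b|); lra.
Qed.

Lemma capped_shift_ge1 x : (forall j, 1 <= x ord0 j) -> capped_shift x = 0.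
Proof. by move=> x1; apply/rowP => j; rewrite !mxE min_r // subr_ge0. Qed.

Lemma capped_shift_lt1 x : ltv x onev -> capped_shift x = x - onev.
Proof.
move=> /forallP x1; apply/rowP => j; have := x1 j; rewrite !mxE => xj.
by rewrite min_l // subr_le0 ltW.
Qed.

Variables (disp : measure_display) (T : measurableType disp) (P : probability T R).
Variable Z : 'I_d -> T -> R.
Hypothesis genZ : is_generator P Z.

(** The standard max-stable distribution function exp(-||x||) with negative
    exponential margins, translated by 1 so that its upper endpoint is that of
    a copula. *)
Definition evd x : R := expR (- Dnorm P Z (capped_shift x)).

(** The norm is homogeneous, so that the n-th power undoes the dilation of
    ratio 1/n about the upper endpoint. *)
Lemma evd_max_stable : max_stable evd.
Proof.
move=> n n0; have n0R : 0 < n%:R :> R by rewrite ltr0n.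
exists (const_mx n%:R^-1), (const_mx (1 - n%:R^-1)); split.
  by apply/forallP => j; rewrite !mxE invr_gt0.
move=> x; rewrite (_ : \row_j _ = zoom n%:R x); last first.
  by apply/rowP => j; rewrite !mxE; ring.
rewrite /evd capped_shift_zoom // (DnormZ genZ) -expRM_natl mulrN mulrA.
by rewrite gtr0_norm ?invr_gt0 // mulfV ?mul1r ?gt_eqF.
Qed.

Lemma evd_continuous : continuous evd.
Proof.
move=> x; apply: (@continuous_comp _ _ _ (fun y => - Dnorm P Z (capped_shift y)) expR);
  last exact: continuous_expR.
apply: (@continuousN _ _ _ (fun y => Dnorm P Z (capped_shift y))).
have sum0 : \sum_j `|x ord0 j - y ord0 j| @[y --> x] --> (0 : R).
  have xx : \sum_j `|x ord0 j - x ord0 j| = 0.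
    by rewrite big1 // => j _; rewrite subrr normr0.
  rewrite -[X in _ --> X]xx.
  apply: (@cvg_big _ _ _ _ _ add_continuous _ (nbhs x) _
    (fun j (y : 'rV[R]_d) => `|x ord0 j - y ord0 j|)) => j _.
  by apply: cvg_norm; apply: cvgB; [exact: cvg_cst|exact: coord_continuous].
have FF : Filter (nbhs x) := nbhs_filter x.
apply/(@cvgrPdist_lt _ _ _ _ FF) => e e0.
move/(@cvgrPdist_lt _ _ _ _ FF) : sum0 => /(_ _ e0).
apply: (@filterS _ _ FF) => y.
rewrite sub0r normrN; apply: le_lt_trans.
rewrite (le_trans (Dnorm_dist genZ _ _)) //.
apply: le_trans (ler_norm _); apply: ler_sum => j _; exact: capped_shift_dist.
Qed.

Lemma evd_le i x : evd x <= expR (x ord0 i - 1).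
Proof.
rewrite ler_expR lerNl; apply: le_trans (Dnorm_ge genZ _ i).
by rewrite !mxE -normrN (le_trans _ (ler_norm _)) // lerN2 ge_min lexx.
Qed.

Lemma evd_gt0 x : 0 < evd x. Proof. exact: expR_gt0. Qed.

Lemma evd_lt1 x i : x ord0 i < 1 -> evd x < 1.
Proof.
by move=> xi; rewrite (le_lt_trans (evd_le i x)) // expR_lt1 subr_lt0.
Qed.

Lemma evd_coord_Ny x i : evd (set_coord x i t) @[t --> -oo] --> (0 : R).
Proof.
have lim0 : expR (t - 1) @[t --> -oo] --> (0 : R).
  rewrite -[X in _ --> X](mulr0 (expR (-1))).
  under eq_fun do rewrite addrC expRD; apply: cvgMl_tmp.
  by apply/cvgNy_compNP; exact: cvgr_expR.
apply: (squeeze_cvgr _ (cvg_cst 0) lim0); near=> t.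
by rewrite ltW ?evd_gt0 //= (le_trans (evd_le i _)) // mxE eqxx.
Unshelve. all: by end_near. Qed.

Lemma evd_diagonal_y : evd (const_mx t) @[t --> +oo] --> (1 : R).
Proof.
apply: cvg_near_cst; near=> t; rewrite /evd capped_shift_ge1 => [|j].
  have -> : (0 : 'rV[R]_d) = 0 *: 0 by rewrite scale0r.
  by rewrite (DnormZ genZ) normr0 mul0r oppr0 expR0.
by rewrite mxE.
Unshelve. all: by end_near. Qed.

(** The margin at 0 lies strictly between 0 and 1, while a degenerate
    distribution function takes no such value. *)
Lemma evd_margin_nondegenerate i : ~ degenerate (margin evd i).
Proof.
pose x1 := set_coord (const_mx 1) i (0 : R).
have marg : margin evd i 0 = evd x1.
  apply: lim_near_cst => //; near=> s.
  have s1 : 1 <= s by [].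
  rewrite /evd; congr (expR (- Dnorm _ _ _)); apply/rowP => j; rewrite !mxE.
  by case: ifP => // _; rewrite !min_r ?subr_ge0.
move=> [a /(_ 0)]; rewrite marg; case: (a <= 0) => E.
  by have := @evd_lt1 x1 i; rewrite E !mxE eqxx ltr01 ltxx => /(_ isT).
by have := evd_gt0 x1; rewrite E ltxx.
Unshelve. all: by end_near.
Qed.

(** Homogeneity gives exp(-||x||) = exp(m (H(1 + (x - 1)/m) - 1)) as soon as m
    is so large that the argument of H lies in the region where H = 1 - ||.||:
    the extreme value distribution is that of the maximum of a Poisson number,
    of mean m, of independent vectors with distribution function
    H(1 + (. - 1)/m). Expanding the exponential of m H as a series in powers
    of H then shows that every box has nonnegative mass. *)
Lemma evd_box_mass_ge0 (H : 'rV[R]_d -> R) x0 :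
  (forall a b, lev a b -> superset_sum (fun S : {set 'I_d} =>
     H (\row_j (if j \in S then a ord0 j else b ord0 j)))) ->
  ltv x0 onev ->
  (forall x, lev x0 x -> H x = 1 - Dnorm P Z (capped_shift x)) ->
  forall a b, lev a b -> 0 <= box_mass evd a b.
Proof.
move=> HS /forallP x01 HN a b /forallP ab.
(* Any m at least (1 - a_j)/(1 - x0_j) for all j sends a above x0. *)
pose m : R := 1 + \sum_j `|1 - a ord0 j| / (1 - x0 ord0 j).
have x0lt j : 0 < 1 - x0 ord0 j by have := x01 j; rewrite !mxE subr_gt0.
have m0 : 0 < m.
  by rewrite ltr_pwDl // sumr_ge0 // => j _; rewrite divr_ge0 // ltW.
have x0_zoom v : lev a v -> lev x0 (zoom m v).
  move=> /forallP av; apply/forallP => j; rewrite mxE.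
  have aj : `|1 - a ord0 j| / (1 - x0 ord0 j) <= m.
    rewrite /m (bigD1 j) //= addrCA lerDl addr_ge0 // sumr_ge0 // => k _.
    by rewrite divr_ge0 // ltW.
  have xj : m^-1 * `|1 - a ord0 j| <= 1 - x0 ord0 j.
    by rewrite mulrC ler_pdivrMr // mulrC -ler_pdivrMr.
  have vj : m^-1 * (1 - v ord0 j) <= m^-1 * `|1 - a ord0 j|.
    rewrite ler_pM2l ?invr_gt0 // (le_trans _ (ler_norm _)) // lerD2l lerN2.
    exact: av.
  by move: xj vj; lra.
have evdE v : lev a v -> evd v = expR (- m) * expR (m * H (zoom m v)).
  move=> av; rewrite HN ?x0_zoom // capped_shift_zoom // (DnormZ genZ) -expRD /evd.
  rewrite gtr0_norm ?invr_gt0 //; congr expR.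
  by rewrite mulrBr mulrA mulfV ?gt_eqF //; ring.
pose vertex (S : {set 'I_d}) : 'rV[R]_d := \row_j (if j \in S then a ord0 j else b ord0 j).
have av S : lev a (vertex S).
  by apply/forallP => j; rewrite mxE; case: ifP.
have -> : box_mass evd a b =
    expR (- m) * alternating_sum (fun S => expR (m * H (zoom m (vertex S)))).
  rewrite /alternating_sum mulr_sumr; apply: eq_bigr => S _.
  by rewrite -/(vertex S) evdE // mulrCA.
rewrite mulr_ge0 ?expR_ge0 //; apply: alternating_sum_expR_ge0.
apply: superset_sumZ; first exact: ltW.
have zab : lev (zoom m a) (zoom m b).
  by apply/forallP => j; rewrite !mxE lerD2l ler_pM2l ?invr_gt0 // lerD2r.
have [q q0 Hq] := HS _ _ zab; exists q => // S; rewrite -Hq; congr H.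
by apply/rowP => j; rewrite !mxE; case: ifP.
Qed.

Lemma is_GPD_of_Dnorm (H : 'rV[R]_d -> R) x0 : (0 < d)%N ->
  is_df H ->
  (forall a b, lev a b -> superset_sum (fun S : {set 'I_d} =>
     H (\row_j (if j \in S then a ord0 j else b ord0 j)))) ->
  ltv x0 onev ->
  (forall x, lev x0 x -> H x = 1 - Dnorm P Z (capped_shift x)) ->
  is_GPD H.
Proof.
move=> d0 dfH HS x01 HN; split => //; exists evd, x0; split.
- split; last exact: evd_max_stable; last exact: evd_margin_nondegenerate.
  split.
  + exact: evd_box_mass_ge0 HS x01 HN.
  + by move=> x; apply: cvg_within_filter; exact: evd_continuous.
  + by move=> x i; exact: evd_coord_Ny.
  + exact: evd_diagonal_y.
- rewrite evd_gt0 /=; apply: (@evd_lt1 _ (Ordinal d0)).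
  by have /forallP/(_ (Ordinal d0)) := x01; rewrite !mxE.
- by move=> x x0x; rewrite HN // /evd expRK.
Qed.

End ExtremeValue.

(** * Almost sure events *)

Section AlmostSure.
Context {R : realType} {disp : measure_display} {T : measurableType disp}.
Variable P : probability T R.

Lemma measure_ae_eq (A B : set T) : measurable A -> measurable B ->
  {ae P, forall t, A t <-> B t} -> P A = P B.
Proof.
move=> mA mB AB; rewrite -(setIT A) -(setIT B) -!integral_indic //.
apply: ae_eq_integral => //.
- by apply/measurable_EFinP/measurable_indic.
- by apply/measurable_EFinP/measurable_indic.
apply: filterS AB => t ABt _; congr EFin; rewrite !indicE.
by congr (nat_of_bool _)%:R; apply/idP/idP; rewrite !inE => /ABt.
Qed.

Lemma ae_of_probability1 (A : set T) : measurable A -> P A = 1%E ->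
  {ae P, forall t, A t}.
Proof.
move=> mA A1; exists (~` A); split => //; first exact: measurableC.
by rewrite probability_setC // A1 subee.
Qed.

Lemma bool_indic (b : T -> bool) : (fun t => (b t)%:R) = \1_[set t | b t] :> (T -> R).
Proof.
by apply/funext => t; rewrite indicE; congr (nat_of_bool _)%:R;
  apply/idP/idP; rewrite inE.
Qed.

Lemma measurable_bool_indic (b : T -> bool) : measurable [set t | b t] ->
  measurable_fun [set: T] (fun t => (b t)%:R : R).
Proof. by move=> mb; rewrite bool_indic; exact: measurable_indic. Qed.

End AlmostSure.

(** * Piecing together *)

Section PiecingTogether.
Context {R : realType} {disp : measure_display} {T : measurableType disp}.
Variables (P : probability T R) (d : nat) (U V Z : 'I_d -> T -> R) (u : 'rV[R]_d).
Hypotheses (rU : is_rvec U) (rV : is_rvec V) (genZ : is_generator P Z).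
Hypotheses (indUV : independent P U V) (indZU : independent P Z U).
Hypothesis exceed : (0 < P [set t | forall j, (u ord0 j < U j t)%R])%E.
Implicit Types (x y : 'rV[R]_d) (S : {set 'I_d}).

Let rZ : is_rvec Z := generator_rvec genZ.
Let indUZ : independent P U Z := independent_sym indZU.

Local Notation us := (ustar P U u).
Local Notation Y := (Ystar P U V u).
Local Notation N := (Dn P U u Z).
Local Notation H := (dfun P Y).

Lemma ustarE j : us ord0 j = fine (P [set t | U j t <= u ord0 j]).
Proof. by rewrite mxE. Qed.

Lemma survivalE j : (1 - us ord0 j)%:E = P [set t | u ord0 j < U j t].
Proof.
have mUj : measurable [set t | U j t <= u ord0 j] by exact: measurable_le_cst.
rewrite ustarE EFinB fineK ?fin_num_measure // -probability_setC //.
by congr (P _); apply/seteqP; split => t /=; rewrite ltNge => /negP.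
Qed.

Lemma survival_gt0 j : 0 < 1 - us ord0 j.
Proof.
rewrite -lte_fin survivalE (lt_le_trans exceed) // le_measure ?inE //.
- by apply: measurable_forall => i; exact: measurable_gt_cst.
- exact: measurable_gt_cst.
by move=> t /=; exact.
Qed.

Definition exceedances (t : T) : {set 'I_d} := [set j | u ord0 j < U j t]%SET.

Lemma sigma_gen_exceedances S : sigma_gen U (exceedances @^-1` [set S]).
Proof.
rewrite sigma_genE; apply: (@measurable_finset_fiber _
  (g_sigma_algebraType (coordinate_events U)) _ (fun j t => u ord0 j < U j t)).
move=> j; apply: (@measurable_gt_cst _ _
  (g_sigma_algebraType (coordinate_events U)) (U j)).
exact: measurable_coordinate.
Qed.

Lemma measurable_exceedances S : measurable (exceedances @^-1` [set S]).
Proof. exact: (sigma_gen_measurable rU (sigma_gen_exceedances S)). Qed.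

(** The vector at which the norm of Z is evaluated once the set of exceedances
    is known to be S. *)
Definition rescale S x : 'rV[R]_d :=
  \row_j (if j \in S then x ord0 j / (1 - us ord0 j) else 0).

Definition exceedance_generator (j : 'I_d) (t : T) : R :=
  Z j t * ((u ord0 j < U j t)%R%:R / (1 - us ord0 j)).

Lemma DnE : N = Dnorm P exceedance_generator.
Proof.
apply/funext => x; rewrite /Dn /Dnorm; congr (fine (expectation P _)).
by apply/funext => t; apply: eq_bigr => j _; rewrite /exceedance_generator !mulrA.
Qed.

(** The factor 1(U_j > u_j)/(1 - u*_j) is independent of Z_j and has mean 1. *)
Lemma exceedance_generatorP : is_generator P exceedance_generator.
Proof.
have [_ [c c0 Zc] EZ] := genZ.
split.
- move=> j; apply: measurable_funM; first exact: rZ.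
  apply: measurable_funM => //; apply: measurable_bool_indic.
  exact: measurable_gt_cst.
- pose k := 1 + \sum_j (1 - us ord0 j)^-1.
  have kj j : (1 - us ord0 j)^-1 <= k.
    rewrite /k (bigD1 j) //= addrCA lerDl addr_ge0 // sumr_ge0 // => i _.
    by rewrite invr_ge0 ltW ?survival_gt0.
  have k0 : 0 < k.
    by rewrite ltr_pwDl // sumr_ge0 // => i _; rewrite invr_ge0 ltW ?survival_gt0.
  exists (c * k); first exact: mulr_gt0.
  apply: filterS Zc => t Zt j; have /andP[Z0 Zcj] := Zt j.
  have i0 : 0 <= (u ord0 j < U j t)%R%:R / (1 - us ord0 j).
    by rewrite divr_ge0 // ltW ?survival_gt0.
  rewrite mulr_ge0 //= ler_pM // (le_trans _ (kj j)) //.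
  by case: (_ < _); rewrite ?mul1r // mul0r invr_ge0 ltW ?survival_gt0.
move=> j.
pose A := [set t | u ord0 j < U j t].
have mA : measurable A by exact: measurable_gt_cst.
pose g t := (1 - us ord0 j)^-1 * `|Z j t|.
have mg : measurable_fun [set: g_sigma_algebraType (coordinate_events Z)] g.
  apply: measurable_funM => //; apply: measurableT_comp => //.
  exact: measurable_coordinate.
have mgT := sigma_gen_measurable_fun rZ mg.
have g0 t : 0 <= g t by rewrite mulr_ge0 // invr_ge0 ltW ?survival_gt0.
(* Passing to |Z_j|, which equals Z_j almost surely, makes the integrand
   nonnegative everywhere. *)
rewrite unlock; transitivity (\int[P]_t (\1_A t * g t)%:E)%E.
  apply: ae_eq_integral => //.
  - apply/measurable_EFinP; apply: measurable_funM; first exact: rZ.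
    apply: measurable_funM => //; apply: measurable_bool_indic.
    exact: measurable_gt_cst.
  - by apply/measurable_EFinP/measurable_funM => //; exact: measurable_indic.
  apply: filterS Zc => t Zt _; have /andP[Z0 _] := Zt j; congr EFin.
  by rewrite -bool_indic /g ger0_norm // /exceedance_generator mulrC -mulrA.
rewrite integral_indic_independent // => [|B mB].
  rewrite /g; under eq_integral do rewrite EFinM.
  rewrite ge0_integralZl_EFin //; last 2 first.
  - by apply/measurable_EFinP; apply: measurableT_comp.
  - by rewrite invr_ge0 ltW ?survival_gt0.
  rewrite (integral_abs_generator genZ) mule1 -survivalE -EFinM.
  by rewrite mulfV // gt_eqF ?survival_gt0.
apply: indUZ; rewrite sigma_genE.
  apply: (@measurable_gt_cst _ _ (g_sigma_algebraType (coordinate_events U)) (U j)).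
  exact: measurable_coordinate.
by have := mg measurableT _ mB; rewrite setTI.
Qed.

Lemma weighted_max_exceedance x t :
  weighted_max exceedance_generator x t = weighted_max Z (rescale (exceedances t) x) t.
Proof.
apply: eq_bigr => j _; rewrite /exceedance_generator [rescale _ _ _ _]mxE inE.
case: (_ < _); last by rewrite mul0r mulr0 normr0 mul0r mulr0.
rewrite mul1r normrM (@gtr0_norm _ (_^-1)) ?invr_gt0 ?survival_gt0 //.
by rewrite mulrA mulrAC.
Qed.

Lemma Dn_exceedances x : N x =
  \sum_S fine (P (exceedances @^-1` [set S])) * Dnorm P Z (rescale S x).
Proof.
have fP S : P (exceedances @^-1` [set S]) \is a fin_num.
  by rewrite fin_num_measure //; exact: measurable_exceedances.
have fZ S : (\int[P]_t (weighted_max Z (rescale S x) t)%:E)%E \is a fin_num.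
  exact: integrable_fin_num (integrable_weighted_max genZ _).
rewrite DnE DnormE /Rintegral.
under eq_integral do rewrite weighted_max_exceedance.
rewrite (integral_freeze (g := fun S => weighted_max Z (rescale S x)) rU rZ indUZ) //.
- rewrite -sum_fine => [|S _]; last by apply: fin_numM; [exact: fP|exact: fZ].
  by apply: eq_bigr => S _; rewrite (fineM (fP S) (fZ S)) DnormE.
- exact: sigma_gen_exceedances.
- move=> S; apply: (@measurable_weighted_max _ _ (g_sigma_algebraType (coordinate_events Z))).
  by move=> j; exact: measurable_coordinate.
- by move=> S t; exact: weighted_max_ge0.
Qed.

Lemma Ystar_rvec : is_rvec Y.
Proof.
move=> j; apply: measurable_funD; apply: measurable_funM.
- exact: rU.
- by apply: measurable_bool_indic; exact: measurable_le_cst.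
- by apply: measurable_funD => //; apply: measurable_funM => //; exact: rV.
- by apply: measurable_bool_indic; exact: measurable_gt_cst.
Qed.

Lemma YstarE j t : Y j t =
  if u ord0 j < U j t then us ord0 j + (1 - us ord0 j) * V j t else U j t.
Proof.
rewrite /Ystar; case: ltP => _; first by rewrite mulr0 mulr1 add0r.
by rewrite mulr1 mulr0 addr0.
Qed.

Variable C : 'rV[R]_d -> R.
Hypothesis dfV : forall w, in_cube w -> dfun P V w = C w.

Lemma onev_in_cube : in_cube (onev : 'rV[R]_d).
Proof. by apply/andP; split; apply/forallP => j; rewrite !mxE. Qed.

Hypothesis copC : is_GPD_copula P Z C.

Lemma C_onev : C onev = 1.
Proof.
have [_ [u0 /forallP u01 CE]] := copC.
rewrite CE ?onev_in_cube //; last by apply/forallP => j; rewrite ltW ?u01.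
by rewrite subrr -(scale0r 0) (DnormZ genZ) normr0 mul0r subr0.
Qed.

Lemma V_le1_ae : {ae P, forall t, lower_orthant V onev t}.
Proof.
apply: ae_of_probability1; first exact: measurable_lower_orthant.
rewrite -[LHS]fineK ?fin_num_measure //; last exact: measurable_lower_orthant.
by rewrite -/(dfun P V onev) dfV ?onev_in_cube // C_onev.
Qed.

(** With s = 1 - u*_j: the event Y_j <= y, for a component exceeding the
    threshold and V_j <= 1, is a lower orthant event for V_j. *)
Lemma le_rescaled (s v y : R) : 0 < s ->
  (v <= 1 + Num.min (y - 1) 0 / s) = (1 - s + s * v <= y) && (v <= 1).
Proof.
move=> s0; rewrite -lerBlDl ler_pdivlMr // le_min pmulr_lle0 // subr_le0.
by congr (_ && _); apply/idP/idP; lra.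
Qed.

(** Above the threshold u, the components of Y* which do not exceed it put no
    constraint on the event Y* <= x, and the others only constrain V; the set
    of exceedances being independent of V, it may be frozen. *)
Lemma dfun_exceedances x : lev u x -> H x =
  \sum_S fine (P (exceedances @^-1` [set S])) *
    dfun P V (onev + rescale S (capped_shift x)).
Proof.
move=> /forallP ux.
have fP S : P (exceedances @^-1` [set S]) \is a fin_num.
  by rewrite fin_num_measure //; exact: measurable_exceedances.
have fV w : P (lower_orthant V w) \is a fin_num.
  by rewrite fin_num_measure //; exact: measurable_lower_orthant.
pose g S : T -> R := \1_(lower_orthant V (onev + rescale S (capped_shift x))).
have mY := measurable_lower_orthant Ystar_rvec.
have mV := measurable_lower_orthant rV.
have HE : P (lower_orthant Y x) = (\int[P]_t (g (exceedances t) t)%:E)%E.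
  rewrite (@measure_ae_eq _ _ _ _ _ (lower_orthant Y x `&` lower_orthant V onev)) //;
    last 2 first.
  - exact: measurableI.
  - by apply: filterS V_le1_ae => t Vt; split => [|[]].
  rewrite -[X in P X]setIT -integral_indic //; last exact: measurableI.
  apply: eq_integral => t _; congr EFin; rewrite !indicE.
  congr (nat_of_bool _)%:R; apply/idP/idP; rewrite !inE.
    move=> [Yt Vt] j; have := Yt j; have := Vt j.
    rewrite YstarE ![(onev + _) _ _]mxE [rescale _ _ _ _]mxE inE [onev _ _]mxE.
    case: ifP => _; last by rewrite addr0.
    by rewrite [capped_shift _ _ _]mxE le_rescaled ?survival_gt0 // subKr => -> ->.
  move=> Vt; split => j; have := Vt j;
    rewrite ?YstarE ![(onev + _) _ _]mxE [rescale _ _ _ _]mxE inE [onev _ _]mxE.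
    case: ltP => [_|Uj _]; last exact: le_trans (ux j).
    by rewrite [capped_shift _ _ _]mxE le_rescaled ?survival_gt0 // subKr => /andP[].
  case: ifP => _; last by rewrite addr0.
  by rewrite [capped_shift _ _ _]mxE le_rescaled ?survival_gt0 // => /andP[].
rewrite /dfun HE (integral_freeze rU rV indUV) //.
- under eq_bigr => S _ do rewrite integral_indic // setIT.
  rewrite -sum_fine => [|S _]; last by apply: fin_numM; [exact: fP|exact: fV].
  by apply: eq_bigr => S _; rewrite (fineM (fP S) (fV _)).
- exact: sigma_gen_exceedances.
- move=> S; apply: measurable_indic.
  apply: (@measurable_lower_orthant _ _ (g_sigma_algebraType (coordinate_events V))).
  by move=> j; exact: measurable_coordinate.
Qed.

(** A copula vanishes at points with a component equal to 0. *)
Lemma V_gt0_ae : {ae P, forall t, forall j, 0 < V j t}.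
Proof.
apply: filter_forall => j.
apply: (@ae_of_probability1 _ _ _ P [set t | 0 < V j t]).
  exact: measurable_gt_cst.
have mV0 : measurable [set t | V j t <= 0] by exact: measurable_le_cst.
have -> : [set t | 0 < V j t] = ~` [set t | V j t <= 0].
  by apply/seteqP; split => t /=; rewrite ltNge => /negP.
rewrite [LHS]probability_setC //.
pose w := set_coord (onev : 'rV[R]_d) j 0.
have mw := measurable_lower_orthant rV w.
rewrite (@measure_ae_eq _ _ _ P _ (lower_orthant V w)) //; last first.
  apply: filterS V_le1_ae => t Vt; split => /= [Vj i|/(_ j)]; last first.
    by rewrite mxE eqxx.
  by rewrite mxE; case: eqP => [->//|_]; exact: Vt.
rewrite -[X in (1 - X)%E]fineK ?fin_num_measure // -/(dfun P V w).
have w01 : in_cube w.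
  by apply/andP; split; apply/forallP => i; rewrite !mxE; case: ifP.
have [[C0 _ _] _] := copC.
by rewrite dfV // (C0 w j) ?sube0 // mxE eqxx.
Qed.

(** An exceedance lifts Y_j above u*_j, because V_j is almost surely positive;
    so below both u and u* the vectors Y* and U* satisfy the same inequalities. *)
Lemma dfun_Ystar_head x : lev x (minv u us) -> H x = dfun P U x.
Proof.
move=> /forallP xle; congr fine; apply: measure_ae_eq.
- exact: measurable_lower_orthant Ystar_rvec _.
- exact: measurable_lower_orthant.
have xu j : x ord0 j <= u ord0 j.
  by have := xle j; rewrite [minv _ _ _ _]mxE le_min => /andP[].
have xus j : x ord0 j <= us ord0 j.
  by have := xle j; rewrite [minv _ _ _ _]mxE le_min => /andP[].
apply: filterS V_gt0_ae => t V0; split => /= Wt j; have := Wt j; rewrite YstarE.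
  case: ltP => // _; rewrite leNgt => /negP[].
  by rewrite (le_lt_trans (xus j)) // ltrDl mulr_gt0 ?survival_gt0.
by move=> Ux; rewrite ltNge (le_trans Ux).
Qed.

Lemma sum_exceedances : \sum_S fine (P (exceedances @^-1` [set S])) = 1.
Proof.
rewrite sum_fine => [|S _]; last first.
  by rewrite fin_num_measure //; exact: measurable_exceedances.
have := total_probability P measurable_exceedances (@measurableT _ T).
rewrite probability_setT; under eq_bigr do rewrite setTI.
by move=> <-.
Qed.

(** Both sides are averages over the set S of exceedances: at the points
    rescaled by S the copula of V equals 1 - ||.||, and the average of the norms
    is the norm D_n. *)
Lemma dfun_Ystar_tail : ltv u onev -> exists2 x0, ltv x0 onev &
  forall x, lev x0 x -> H x = 1 - N (capped_shift x).
Proof.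
move=> /forallP u1; have [_ [u0 /forallP u01 CE]] := copC.
(* C is known only on the unit cube, hence the maximum with 0. *)
pose v j := Num.max (u0 ord0 j) 0.
have v1 j : v j < 1 by have := u01 j; rewrite mxE gt_max ltr01 andbT.
(* With this choice, x >= x0 implies that the rescaled points lie above v. *)
pose x0 : 'rV[R]_d :=
  \row_j Num.max (u ord0 j) (1 - (1 - us ord0 j) * (1 - v j)).
exists x0.
  apply/forallP => j; rewrite [x0 _ _]mxE [onev _ _]mxE gt_max.
  have := u1 j; rewrite mxE => -> /=.
  by rewrite ltrBlDr ltrDl mulr_gt0 ?survival_gt0 // subr_gt0.
move=> x /forallP x0x.
have ux : lev u x.
  apply/forallP => j; apply: le_trans (x0x j).
  by rewrite [x0 _ _]mxE le_max lexx.
rewrite (dfun_exceedances ux) Dn_exceedances -sum_exceedances -sumrB.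
apply: eq_bigr => S _; rewrite -[X in _ = X - _]mulr1 -mulrBr; congr (_ * _).
pose w := onev + rescale S (capped_shift x).
have wv j : v j <= w ord0 j.
  rewrite [w _ _]mxE [onev _ _]mxE [rescale _ _ _ _]mxE.
  case: ifP => _; last by rewrite addr0 ltW.
  rewrite [capped_shift _ _ _]mxE le_rescaled ?survival_gt0 // (ltW (v1 j)) andbT.
  have := x0x j; rewrite [x0 _ _]mxE ge_max => /andP[_]; apply: le_trans.
  lra.
have w01 : in_cube w.
  apply/andP; split; apply/forallP => j.
    by rewrite mxE (le_trans _ (wv j)) // le_max lexx orbT.
  rewrite [w _ _]mxE [onev _ _]mxE [rescale _ _ _ _]mxE gerDl.
  case: ifP => // _; rewrite pmulr_lle0 ?invr_gt0 ?survival_gt0 //.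
  by rewrite [capped_shift _ _ _]mxE ge_min lexx orbT.
rewrite -/w dfV // CE //; last first.
  by apply/forallP => j; rewrite (le_trans _ (wv j)) // le_max lexx.
by rewrite /w addrAC subrr add0r.
Qed.

End PiecingTogether.

Theorem proposition3p3 (R : realType) (d n : nat) (d_gt0 : (0 < d)%N) (n_gt0 : (0 < n)%N)
    (disp : measure_display) (T : measurableType disp) (P : probability T R)
    (X0 : 'I_d -> T -> R) (X : 'I_n -> 'I_d -> T -> R)
    (rX0 : is_rvec X0) (rX : forall i, is_rvec (X i))
    (copies : forall i, dfun P (X i) = dfun P X0)
    (Pn : T -> probability T R)
    (condPn : is_cond_prob P
       (sigma_gen (fun ij : 'I_n * 'I_d => X ij.1 ij.2)) Pn)
    (omega : T)
    (U V Z : 'I_d -> T -> R) (rU : is_rvec U) (rV : is_rvec V)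
    (C : 'rV[R]_d -> R) (u : 'rV[R]_d) :
  let Cn := empirical_copula (fun i => \row_j X i j omega) in
  (forall w, in_cube w -> dfun (Pn omega) U w = Cn w) ->
  is_generator (Pn omega) Z ->
  is_GPD_copula (Pn omega) Z C ->
  (forall w, in_cube w -> dfun (Pn omega) V w = C w) ->
  independent (Pn omega) U V ->
  independent (Pn omega) Z U ->
  ltv zerov u -> ltv u onev ->
  (0 < Pn omega [set t | forall j, (u ord0 j < U j t)%R])%E ->
  let us := ustar (Pn omega) U u in
  let H := dfun (Pn omega) (Ystar (Pn omega) U V u) in
  let N := Dn (Pn omega) U u Z in
  [/\ is_GPD H,
      forall x, lev zerov x -> lev x (minv u us) -> H x = Cn x,
      is_Dnorm N &
      exists2 x0, ltv x0 onev &
        forall x, lev x0 x -> ltv x onev -> H x = 1 - N (x - onev)].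
Proof.
move=> Cn dfU genZ copC dfV indUV indZU _ u1 exceed us H N.
have genZ' := exceedance_generatorP rU genZ indZU exceed.
have NE : N = Dnorm (Pn omega) (exceedance_generator (Pn omega) U Z u) := DnE _ _ _ _.
have rY := Ystar_rvec (Pn omega) u rU rV.
have [x0 x01 Htail] := dfun_Ystar_tail rU rV genZ indUV indZU exceed dfV copC u1.
split.
- apply: (is_GPD_of_Dnorm genZ' d_gt0 (dfun_is_df _ rY d_gt0) _ x01).
    by move=> a b ab; exact: dfun_superset_sum.
  by move=> x x0x; rewrite -NE; exact: Htail.
- move=> x xge0 xu; rewrite /H (dfun_Ystar_head rU rV genZ exceed dfV copC xu).
  apply: dfU; apply/andP; split => //.
  apply/forallP => j; have /forallP/(_ j) := xu; rewrite [minv _ _ _ _]mxE le_min.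
  move=> /andP[xj _]; apply: le_trans xj _.
  by have /forallP/(_ j) := u1; exact: ltW.
- by rewrite NE; exact: Dnorm_is_Dnorm.
- exists x0 => // x x0x x1; rewrite -(capped_shift_lt1 x1); exact: Htail.
Qed.
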